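(* Let $k,d\ge2$, $R\ge1$, $\kappa\in(0,1]$, $\lambda>0$, and let $\boldsymbol Y=\lambda\boldsymbol\sigma^\star+\boldsymbol W$ with $\boldsymbol W$ a standard Gaussian symmetric tensor. Let $$\Gamma_{R,\kappa}:=\sup\{|\langle\boldsymbol W,\boldsymbol\sigma\rangle|:\boldsymbol\sigma\in\mathfrak S_R,\ \kappa(\boldsymbol\sigma)\ge\kappa\}.$$ Assume $\boldsymbol\sigma^\star\in\mathfrak S_R$ satisfies $\kappa(\boldsymbol\sigma^\star)\ge\kappa$. Then any estimator $\hat{\boldsymbol\sigma}\in\mathfrak S_R$ with $\kappa(\hat{\boldsymbol\sigma})\ge\kappa$ satisfying $\langle\boldsymbol Y,\hat{\boldsymbol\sigma}\rangle\ge\langle\boldsymbol Y,\boldsymbol\sigma^\star\rangle$ obeys, almost surely, $$\|\hat{\boldsymbol\sigma}-\boldsymbol\sigma^\star\|_F^2\le\frac{4\,\Gamma_{R,\kappa}}{\lambda}.$$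
   Context: The space $\mathcal{T}(k,d)$ of real symmetric tensors of order $k$ and dimension $d$ carries the entrywise (Frobenius) inner product $\langle\cdot,\cdot\rangle$ and norm $\|\cdot\|_F$. The standard Gaussian symmetric tensor $\boldsymbol W$ has density proportional to $\exp(-\|\boldsymbol W\|_F^2/2)$ on $\mathcal T(k,d)$. $\mathfrak S_R$ is the set of symmetric tensors of rank at most $R$ with Frobenius norm $1$, each written as a rank-$R$ decomposition $\boldsymbol\sigma=\sum_{j=1}^Ra_jt_j^{\otimes k}$ with $a_j\ne0$, $t_j\in\mathbb S^{d-1}$ pairwise distinct. The coherence $\kappa(\boldsymbol\sigma)\in(0,1]$ is defined by $\kappa^2(\boldsymbol\sigma)=\max\lambda_{\min}(\boldsymbol G)$, $G_{ij}=\langle t_i,t_j\rangle^k$, with the maximum over all rank-$R$ decompositions of $\boldsymbol\sigma$. *)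

(* Defs.v *)
From HB Require Import structures.
From mathcomp Require Import all_boot all_order all_algebra all_fingroup.
From mathcomp Require Import all_classical all_reals all_analysis.

Set Implicit Arguments.
Unset Strict Implicit.
Unset Printing Implicit Defensive.

Import Order.TTheory GRing.Theory Num.Theory.
Import numFieldNormedType.Exports.

Local Open Scope classical_set_scope.
Local Open Scope ring_scope.

(* A tensor of order k and dimension d is a function of multi-indices
   (i_1, ..., i_k), encoded as k-tuples over 'I_d.                            *)
Section SymmetricTensors.
Variables (R : realType) (k d : nat).

Definition perm_index (s : 'S_k) (i : k.-tuple 'I_d) : k.-tuple 'I_d :=
  [tuple tnth i (s j) | j < k].

Definition is_symmetric : {pred {ffun k.-tuple 'I_d -> R^o}} :=
  fun T => [forall s : 'S_k, forall i, T (perm_index s i) == T i].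

Lemma is_symmetricP (T : {ffun k.-tuple 'I_d -> R^o}) :
  reflect (forall (s : 'S_k) i, T (perm_index s i) = T i) (T \in is_symmetric).
Proof.
apply: (iffP forallP) => [h s i|h s]; first by have /forallP/(_ i)/eqP := h s.
by apply/forallP => i; rewrite h.
Qed.

Lemma is_symmetric_submod_closed : GRing.submod_closed is_symmetric.
Proof.
split=> [|a T U /is_symmetricP hT /is_symmetricP hU]; apply/is_symmetricP => s i.
  by rewrite !ffunE.
by rewrite !ffunE hT hU.
Qed.

HB.instance Definition _ :=
  GRing.isSubmodClosed.Build R {ffun k.-tuple 'I_d -> R^o} is_symmetric
    is_symmetric_submod_closed.

Record symtensor := SymTensor {
  symtensor_val :> {ffun k.-tuple 'I_d -> R^o};
  _ : symtensor_val \in is_symmetric }.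

HB.instance Definition _ := [isSub for symtensor_val].
HB.instance Definition _ := [Choice of symtensor by <:].
HB.instance Definition _ := [SubChoice_isSubLmodule of symtensor by <:].
HB.instance Definition _ := isPointed.Build symtensor 0.

Definition entry (i : k.-tuple 'I_d) (T : symtensor) : R := T i.

Definition entry_preimages : set (set symtensor) :=
  [set A | exists i (B : set R), measurable B /\ A = entry i @^-1` B].

HB.instance Definition _ :=
  @isMeasurable.Build (sigma_display entry_preimages) symtensor
    <<s entry_preimages >> (@sigma_algebra0 _ setT entry_preimages)
    (@sigma_algebraC symtensor entry_preimages)
    (@sigma_algebra_bigcup _ setT entry_preimages).

Definition tensor_dot (T U : symtensor) : R := \sum_i T i * U i.

Definition frob (T : symtensor) : R := Num.sqrt (tensor_dot T T).

Lemma tpow_subproof (t : 'rV[R]_d) :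
  [ffun i : k.-tuple 'I_d => \prod_(j < k) t ord0 (tnth i j) : R^o]
    \in is_symmetric.
Proof.
apply/is_symmetricP => s i; rewrite !ffunE [RHS](reindex_inj (@perm_inj _ s)).
by apply: eq_bigr => j _; rewrite tnth_mktuple.
Qed.

Definition tpow (t : 'rV[R]_d) : symtensor := SymTensor (tpow_subproof t).

End SymmetricTensors.

Section Coherence.
Variables (R : realType) (k d r : nat).

Definition dotv (u v : 'rV[R]_d) : R := \sum_i u ord0 i * v ord0 i.

Definition is_rank_decomposition (sigma : symtensor R k d)
    (a : 'I_r -> R) (t : 'I_r -> 'rV[R]_d) : Prop :=
  [/\ forall j, a j != 0,
      forall j, dotv (t j) (t j) = 1,
      injective t
    & sigma = \sum_(j < r) a j *: tpow k (t j)].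

(* For 2 <= d this is the whole set of unit-norm symmetric tensors of rank at
   most r: a shorter minimal decomposition can be padded to exactly r nonzero
   terms with distinct unit vectors by splitting a term along t and - t and by
   adding pairs of terms along u and - u that cancel.                         *)
Definition rank_sphere : set (symtensor R k d) :=
  [set sigma | frob sigma = 1 /\ exists a t, is_rank_decomposition sigma a t].

Definition gram (t : 'I_r -> 'rV[R]_d) : 'M[R]_r :=
  \matrix_(i, j) dotv (t i) (t j) ^+ k.

(* For a real symmetric matrix of positive size the set of eigenvalues is
   finite and nonempty, so the infimum is a minimum.                          *)
Definition lambda_min n (M : 'M[R]_n) : R := inf [set x | eigenvalue M x].

(* Decompositions with r nonzero coefficients do not form a compact set; the
   supremum is the maximum whenever the latter is attained.                   *)
Definition coherence (sigma : symtensor R k d) : R :=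
  Num.sqrt (sup [set x | exists a t,
    is_rank_decomposition sigma a t /\ x = lambda_min (gram t)]).

Definition Gamma (kappa : R) (W : symtensor R k d) : R :=
  sup [set x | exists sigma, [/\ rank_sphere sigma,
    kappa <= coherence sigma & x = `|tensor_dot W sigma|]].

End Coherence.

Section Lebesgue.
Variable R : realType.

Definition tuple_cons n (p : n.-tuple R * R) : n.+1.-tuple R :=
  [tuple of p.2 :: p.1].

Lemma measurable_tuple_cons n : measurable_fun setT (@tuple_cons n).
Proof. exact: (measurable_cons measurable_snd measurable_fst). Qed.

Definition push d1 d2 (T1 : measurableType d1) (T2 : measurableType d2)
    (m : {measure set T1 -> \bar R}) (f : T1 -> T2)
    (mf : measurable_fun setT f) : {measure set T2 -> \bar R} :=
  ltac:(exact: (pushforward m f)).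

Fixpoint lebesgue_tuple n : {measure set (n.-tuple R) -> \bar R} :=
  if n is m.+1 return {measure set (n.-tuple R) -> \bar R} then
    push (lebesgue_tuple m \x @lebesgue_measure R)%E (@measurable_tuple_cons m)
  else dirac [tuple].

Variables k d : nat.

Definition ord_le : rel 'I_d := fun i j => (i <= j)%N.

Definition sorted_index := {i : k.-tuple 'I_d | sorted ord_le i}.

Lemma sort_index_subproof (i : k.-tuple 'I_d) :
  sorted ord_le [tuple of sort ord_le i].
Proof. by apply: sort_sorted => a b; exact: leq_total. Qed.

Definition sort_index (i : k.-tuple 'I_d) : sorted_index :=
  exist (fun i : k.-tuple 'I_d => sorted ord_le i) _ (sort_index_subproof i).

Lemma sort_index_perm (s : 'S_k) (i : k.-tuple 'I_d) :
  sort_index (perm_index s i) = sort_index i.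
Proof.
apply/val_inj/val_inj => /=; apply/perm_sortP.
- by move=> a b; exact: leq_total.
- by move=> b a c; exact: leq_trans.
- by move=> a b /anti_leq/val_inj.
- by apply/tuple_permP; exists s.
Qed.

Lemma tensor_of_coords_subproof (x : #|{: sorted_index}|.-tuple R) :
  [ffun i : k.-tuple 'I_d => tnth x (enum_rank (sort_index i)) : R^o]
    \in @is_symmetric R k d.
Proof. by apply/is_symmetricP => s i; rewrite !ffunE sort_index_perm. Qed.

Definition tensor_of_coords (x : #|{: sorted_index}|.-tuple R) :
  symtensor R k d := SymTensor (tensor_of_coords_subproof x).

Lemma measurable_tensor_of_coords : measurable_fun setT tensor_of_coords.
Proof.
apply: (@measurability _ _ _ _ setT _ (@entry_preimages R k d)) => // _ [_ [i [B [mB ->]] <-]].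
rewrite [X in measurable X](_ : _ =
  setT `&` (@tnth _ R ^~ (enum_rank (sort_index i))) @^-1` B).
  exact: measurable_tnth.
by apply/seteqP; split=> x; rewrite /= /entry /= ffunE.
Qed.

(* The entries at nondecreasing multi-indices are linear coordinates on the
   space of symmetric tensors.  They are not orthonormal for the Frobenius
   product, so this is the Lebesgue measure only up to a positive constant. *)
Definition lebesgue_symtensor : {measure set (symtensor R k d) -> \bar R} :=
  push (lebesgue_tuple #|{: sorted_index}|) measurable_tensor_of_coords.

Definition std_gaussian dO (Omega : measurableType dO) (P : probability Omega R)
    (W : {RV P >-> symtensor R k d}) : Prop :=
  exists2 c : R, 0 < c & forall A, measurable A ->
    distribution P W A =
    (\int[lebesgue_symtensor]_(T in A) (c * expR (- frob T ^+ 2 / 2))%:E)%E.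

End Lebesgue.

(* Main.v *)
(* Since both tensors have unit norm, |s - s*|^2 = 2 (1 - <s*, s>), and
   <Y, s*> <= <Y, s> says that lambda (1 - <s*, s>) <= <W, s> - <W, s*>, which
   is at most 2 Gamma because s and s* both compete in the supremum Gamma. *)
Require Import Defs.
From HB Require Import structures.
From mathcomp Require Import all_boot all_order all_algebra all_fingroup.
From mathcomp Require Import all_classical all_reals all_analysis.
From mathcomp Require Import ring lra.

Import Order.TTheory GRing.Theory Num.Theory.
Import numFieldNormedType.Exports.

Local Open Scope classical_set_scope.
Local Open Scope ring_scope.

Section TensorDot.
Variables (R : realType) (k d : nat).
Implicit Types T U V : symtensor R k d.

Lemma tensor_dotC T U : tensor_dot T U = tensor_dot U T.
Proof. by apply: eq_bigr => i _; rewrite mulrC. Qed.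

Lemma tensor_dotDl T U V :
  tensor_dot (T + U) V = tensor_dot T V + tensor_dot U V.
Proof. by rewrite -big_split; apply: eq_bigr => i _; rewrite ffunE mulrDl. Qed.

Lemma tensor_dotZl (a : R) T U : tensor_dot (a *: T) U = a * tensor_dot T U.
Proof. by rewrite mulr_sumr; apply: eq_bigr => i _; rewrite ffunE mulrA. Qed.

Lemma tensor_dotBl T U V :
  tensor_dot (T - U) V = tensor_dot T V - tensor_dot U V.
Proof. by rewrite tensor_dotDl -scaleN1r tensor_dotZl mulN1r. Qed.

Lemma tensor_dot_ge0 T : 0 <= tensor_dot T T.
Proof. by apply: sumr_ge0 => i _; rewrite -expr2 sqr_ge0. Qed.

Lemma frob_sqr T : frob T ^+ 2 = tensor_dot T T.
Proof. by rewrite sqr_sqrtr ?tensor_dot_ge0. Qed.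

Lemma frob_subr_sqr T U :
  frob (T - U) ^+ 2 = frob T ^+ 2 - 2 * tensor_dot U T + frob U ^+ 2.
Proof.
(* Only left linearity is available, so symmetry moves [T - U] to the left before the second
   expansion. *)
rewrite !frob_sqr tensor_dotBl !(tensor_dotC _ (T - U)) !tensor_dotBl.
by rewrite (tensor_dotC T U); ring.
Qed.

(** A termwise arithmetic-geometric mean inequality stands in for Cauchy-Schwarz: on unit tensors it
    still gives a finite bound, which is enough for [Gamma] to be a genuine supremum. *)
Lemma normr_tensor_dot_le T U :
  `|tensor_dot T U| <= (frob T ^+ 2 + frob U ^+ 2) / 2.
Proof.
rewrite !frob_sqr -big_split mulr_suml /=.
apply: le_trans (ler_norm_sum _ _ _) _; apply: ler_sum => i _.
(* The square of the difference bounds the product from above, that of the sum from below. *)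
have := sqr_ge0 (T i - U i : R); have := sqr_ge0 (T i + U i : R).
by rewrite ler_norml; nra.
Qed.

(** Boundedness must be checked, as [sup] defaults to 0 on sets that are not bounded above. *)
Lemma normr_tensor_dot_le_Gamma r (kappa : R) (W sigma : symtensor R k d) :
  rank_sphere r sigma -> kappa <= coherence r sigma ->
  `|tensor_dot W sigma| <= Gamma r kappa W.
Proof.
move=> sigma_rank sigma_coh; apply: ub_le_sup; last by exists sigma.
(* The 1 is [frob tau ^+ 2], so the bound is uniform over the competitors. *)
exists ((frob W ^+ 2 + 1) / 2) => _ [tau [[tau1 _] _ ->]].
by have := normr_tensor_dot_le W tau; rewrite tau1 expr1n.
Qed.

Lemma frob_subr_sqr_le_Gamma r (kappa lambda : R)
    (W sigma tau : symtensor R k d) :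
  0 < lambda ->
  rank_sphere r tau -> kappa <= coherence r tau ->
  rank_sphere r sigma -> kappa <= coherence r sigma ->
  tensor_dot (lambda *: tau + W) tau <= tensor_dot (lambda *: tau + W) sigma ->
  frob (sigma - tau) ^+ 2 <= 4 * Gamma r kappa W / lambda.
Proof.
move=> lambda_gt0 tau_rank tau_coh sigma_rank sigma_coh.
have := normr_tensor_dot_le_Gamma _ _ W _ tau_rank tau_coh.
have := normr_tensor_dot_le_Gamma _ _ W _ sigma_rank sigma_coh.
rewrite ler_pdivlMr // frob_subr_sqr !tensor_dotDl !tensor_dotZl -(frob_sqr tau).
have [-> _] := tau_rank; have [-> _] := sigma_rank.
(* Only [tensor_dot W sigma <= Gamma] and [- Gamma <= tensor_dot W tau] are kept; with norms equal
   to 1, everything is linear once [lambda * tensor_dot tau sigma] is taken as an atom. *)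
by rewrite !ler_norml expr1n => /andP[_ ?] /andP[? _] ?; lra.
Qed.

End TensorDot.

Theorem lemma8 (R : realType) (k d r : nat) (kappa lambda : R)
    (dO : measure_display) (Omega : measurableType dO)
    (P : probability Omega R) (W : {RV P >-> symtensor R k d})
    (sigma_star : symtensor R k d)
    (sigma_hat : {mfun symtensor R k d >-> symtensor R k d})
    (k_ge2 : (2 <= k)%N) (d_ge2 : (2 <= d)%N) (r_ge1 : (1 <= r)%N)
    (kappa_gt0 : 0 < kappa) (kappa_le1 : kappa <= 1) (lambda_gt0 : 0 < lambda)
    (gaussW : std_gaussian W)
    (star_rank : rank_sphere r sigma_star)
    (star_coherence : kappa <= coherence r sigma_star) :
  let Y := fun w : Omega => lambda *: sigma_star + W w in
  {ae P, forall w,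
     [/\ rank_sphere r (sigma_hat (Y w)),
         kappa <= coherence r (sigma_hat (Y w))
       & tensor_dot (Y w) sigma_star <= tensor_dot (Y w) (sigma_hat (Y w))]} ->
  {ae P, forall w,
     frob (sigma_hat (Y w) - sigma_star) ^+ 2
       <= 4 * Gamma r kappa (W w) / lambda}.
Proof.
(* The bound is deterministic at each [w], so it holds on the same almost sure event as the
   assumptions on the estimator. *)
move=> Y; apply: filterS => w [hat_rank hat_coherence hat_score].
exact: frob_subr_sqr_le_Gamma.
Qed.
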